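(* Let $r\ge2$ be fixed and let $\epsilon>0$ and $M>1$ be given. Let $G$ be a simple $d$-regular $r$-partite $r$-uniform hypergraph with $n\le d^M$ vertices in each class. For each vertex $v\in V(G)$ let a list $L(v)$ of size $\ell=\lfloor(1+\epsilon)g(r,0)\log_r d\rfloor$ be chosen uniformly at random from the $\ell$-subsets of a palette of size $t\ge\ell$, independently of the other choices. Then, with probability tending to one as $d\to\infty$, $G$ is $L$-chooseable.
   Context: An $r$-partite $r$-uniform hypergraph has vertex classes $V_1,\dots,V_r$ (disjoint, each of size $n$) and each edge contains exactly one vertex from each class; it is simple if distinct edges share at most one vertex. $G$ is $L$-chooseable if one can pick $c(v)\in L(v)$ for every vertex $v$ so that no edge has all its vertices of the same colour. Definition of $g(r,0)$: For a total order $<$ on $[m]$ and $k\in[m]$, ${\rm rpos}_<(k)=\frac1m|\{j\in[m]:j\le k\text{ in }<\}|$. An $(r,m)$-preference order is $P=(<_1,\dots,<_r)$, total orders on $[m]$; $x\in P$ means $x=({\rm rpos}_{<_1}(k),\dots,{\rm rpos}_{<_r}(k))$ for some $k$. For $x\in[0,1]^r$, $i_x=\min\{i:x_i=\max_jx_j\}$. For $0\le\theta\le1/r$: $f_P(\theta)=\max\{\prod_{i\ne i_x}x_i:x\in P,\ x\in[\theta,1]^r\}$, $f(r,\theta,m)=\min_Pf_P(\theta)$ over $(r,m)$-preference orders, $f(r,\theta)=\inf_m f(r,\theta,m)$. For $0<\alpha\le r-1$ let $\beta(\alpha)=\sup\{\theta\in[0,1/r]:\theta^\alpha\le f(r,\theta)\}$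 (the solution of $\theta^\alpha=f(r,\theta)$) and $g(r,\alpha)=-1/\log_rf(r,\beta(\alpha))$. $g(r,\alpha)$ is constant for $\alpha\in(0,1]$ and $g(r,0)$ denotes this constant. *)

(* Defs.v *)
From mathcomp Require Import all_boot all_order all_algebra.
From mathcomp Require Import all_classical all_reals all_analysis.

Set Implicit Arguments.
Unset Strict Implicit.
Unset Printing Implicit Defensive.

Import Order.TTheory GRing.Theory Num.Theory.

Local Open Scope ring_scope.

(** * Hypergraphs *)

(* A hypergraph on the finite vertex type V is its set of edges. The vertex
   classes V_1, ..., V_r are the fibres of part : V -> 'I_r. *)
Section Hypergraphs.
Variable V : finType.
Implicit Types (E : {set {set V}}) (r n d : nat).

Definition uniform r E : Prop := forall e, e \in E -> #|e| = r.

Definition classes_of_size r n (part : V -> 'I_r) : Prop :=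
  forall i : 'I_r, #|[pred v | part v == i]| = n.

Definition partite r (part : V -> 'I_r) E : Prop :=
  forall e, e \in E -> forall i : 'I_r, #|[pred v in e | part v == i]| = 1%N.

Definition simple E : Prop :=
  forall e1 e2, e1 \in E -> e2 \in E -> e1 != e2 -> (#|e1 :&: e2| <= 1)%N.

Definition regular d E : Prop :=
  forall v : V, #|[pred e in E | v \in e]| = d.

Definition chooseable (C : finType) E (L : {ffun V -> {set C}}) : bool :=
  [exists c : {ffun V -> C},
    [forall v, c v \in L v] &&
    [forall e in E, ~~ [exists a : C, [forall v in e, c v == a]]]].

End Hypergraphs.

(** * Random lists *)

(* The uniform distribution on the l-subsets of C. *)
Definition unif_subset (R : realType) (C : finType) (l : nat) (A : {set C}) : R :=
  if #|A| == l then ('C(#|C|, l)%:R)^-1 else 0.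

(* The probability of the event Q when the lists L v, for v in V, are
   independent and uniform on the l-subsets of C. *)
Definition prob_lists (R : realType) (V C : finType) (l : nat)
    (Q : pred {ffun V -> {set C}}) : R :=
  \sum_(L : {ffun V -> {set C}} | Q L) \prod_(v : V) unif_subset R l (L v).

(** * Preference orders and the constant g(r,0) *)

Definition logb (R : realType) (b x : R) : R := ln x / ln b.

(* A total order on [m] is given by its reflexive relation. *)
Definition preference_order (r m : nat) (P : 'I_r -> rel 'I_m) : Prop :=
  forall i, [/\ antisymmetric (P i), transitive (P i) & total (P i)].

Definition rpos (R : realType) (m : nat) (le : rel 'I_m) (k : 'I_m) : R :=
  #|[pred j | le j k]|%:R / m%:R.

(* is_imax x i holds when i = i_x, the least index of a maximal coordinate. *)
Definition is_imax (R : realType) (r : nat) (x : 'I_r -> R) (i : 'I_r) : bool :=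
  [forall j, x j <= x i] &&
  [forall j, [forall k, x k <= x j] ==> (i <= j)%N].

Definition prod_nonmax (R : realType) (r : nat) (x : 'I_r -> R) : R :=
  \prod_(i | ~~ is_imax x i) x i.

(* For 0 <= theta <= 1/r and m > 0 the maximum ranges over a nonempty set of
   nonnegative numbers, so the default value 0 plays no role. *)
Definition f_pref (R : realType) (r m : nat) (P : 'I_r -> rel 'I_m) (theta : R) : R :=
  \big[Num.max/0]_(k : 'I_m | [forall i, theta <= rpos R (P i) k <= 1])
    prod_nonmax (fun i => rpos R (P i) k).

Local Open Scope classical_set_scope.

(* There are finitely many preference orders, so this infimum is a minimum. *)
Definition f_size (R : realType) (r : nat) (theta : R) (m : nat) : R :=
  inf [set f_pref P theta | P in @preference_order r m].

Definition f_inf (R : realType) (r : nat) (theta : R) : R :=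
  inf [set f_size r theta m | m in [set m | (0 < m)%N]].

Definition beta (R : realType) (r : nat) (alpha : R) : R :=
  sup [set theta : R |
    0 <= theta <= r%:R^-1 /\ theta `^ alpha <= f_inf r theta].

Definition g (R : realType) (r : nat) (alpha : R) : R :=
  - 1 / logb r%:R (f_inf r (beta r alpha)).

(* g(r,0) is the constant value of g(r,alpha) over 0 < alpha <= 1, taken here
   at alpha = 1; see g_constant below. *)
Definition g0 (R : realType) (r : nat) : R := g r 1.

Section Constancy.
Variables (R : realType) (r : nat).
Hypothesis r_ge2 : (2 <= r)%N.
Implicit Types theta alpha : R.

Lemma rpos_ge0 m (le : rel 'I_m) k : 0 <= rpos R le k.
Proof. by rewrite divr_ge0. Qed.

Lemma rpos_le1 m (le : rel 'I_m) k : rpos R le k <= 1.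
Proof.
have m_gt0 : (0 < m)%N by apply: leq_trans (ltn_ord k).
rewrite ler_pdivrMr ?ltr0n// mul1r ler_nat.
by rewrite -[leqRHS]card_ord max_card.
Qed.

Lemma prod_nonmax_ge0 (x : 'I_r -> R) : (forall i, 0 <= x i) -> 0 <= prod_nonmax x.
Proof. by move=> x0; apply: prodr_ge0. Qed.

Lemma prod_nonmax_le (x : 'I_r -> R) i :
  (forall j, 0 <= x j <= 1) -> prod_nonmax x <= x i.
Proof.
move=> x01.
have nonmax j : ~~ is_imax x j -> prod_nonmax x <= x j.
  move=> jx; rewrite /prod_nonmax (bigD1 j)//=.
  rewrite ler_piMr//; first by case/andP: (x01 j).
  by apply: prodr_ile1 => k _; exact: x01.
have [ix|] := boolP (is_imax x i); last exact: nonmax.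
have [j ji] : exists j : 'I_r, j != i.
  case: r r_ge2 i {x x01 nonmax ix} => [//|[//|n]] _ i.
  have [->|i0] := eqVneq i ord0; first by exists ord_max.
  by exists ord0; rewrite eq_sym.
have xji : x j <= x i by case/andP: ix => /forallP.
apply: le_trans xji; apply: nonmax; apply/negP => jx.
move: ix jx => /andP[ix1 /forallP ix2] /andP[jx1 /forallP jx2].
have := ix2 j; have := jx2 i; rewrite ix1 jx1 /= => ij ji'.
by move/eqP: ji; apply; apply/val_inj/eqP; rewrite eqn_leq ij ji'.
Qed.

Lemma f_pref_ge0 m (P : 'I_r -> rel 'I_m) theta : 0 <= f_pref P theta.
Proof. exact: bigmax_ge_id. Qed.

Lemma f_pref_le m (P : 'I_r -> rel 'I_m) theta :
  0 <= theta -> f_pref P theta <= f_pref P 0.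
Proof.
move=> t0; apply/bigmax_leP; split=> [|k /forallP Pk]; first exact: bigmax_ge_id.
apply: le_bigmax_cond; apply/forallP => i.
by rewrite rpos_ge0 rpos_le1.
Qed.

Lemma f_pref_eq m (P : 'I_r -> rel 'I_m) theta :
  0 <= theta -> theta <= f_pref P 0 -> f_pref P theta = f_pref P 0.
Proof.
move=> t0 tf; apply/eqP; rewrite eq_le f_pref_le//= leNgt; apply/negP => ff.
have fgt := le_lt_trans (f_pref_ge0 P theta) ff.
suff : f_pref P (0 : R) < f_pref P 0 by rewrite ltxx.
rewrite {1}/f_pref; apply/bigmax_ltP; split=> // k _.
rewrite ltNge; apply/negP => fk.
suff : f_pref P 0 <= f_pref P theta by rewrite leNgt ff.
apply: (le_trans fk); apply: le_bigmax_cond; apply/forallP => i.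
rewrite rpos_le1 andbT; apply: (le_trans tf); apply: (le_trans fk).
by apply: prod_nonmax_le => j; rewrite rpos_ge0 rpos_le1.
Qed.

Lemma preference_order_exists m :
  [set P | @preference_order r m P] !=set0.
Proof.
exists (fun=> [rel j k : 'I_m | (j <= k)%N]) => i; split=> [j k|k j l|j k] /=.
- by move=> jk; apply/val_inj/eqP; rewrite eqn_leq.
- exact: leq_trans.
- exact: leq_total.
Qed.

Lemma f_size_lbound m theta :
  lbound [set f_pref P theta | P in @preference_order r m] 0.
Proof. by move=> _ [P _ <-]; exact: f_pref_ge0. Qed.

Lemma f_size_ge0 m theta : 0 <= f_size r theta m.
Proof.
apply: lb_le_inf (@f_size_lbound m theta).
by have [P hP] := preference_order_exists m; exists (f_pref P theta), P.
Qed.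

Lemma f_inf_lbound theta :
  lbound [set f_size r theta m | m in [set m | (0 < m)%N]] 0.
Proof. by move=> _ [m _ <-]; exact: f_size_ge0. Qed.

Lemma f_inf_nonempty theta :
  [set f_size r theta m | m in [set m | (0 < m)%N]] !=set0.
Proof. by exists (f_size r theta 1), 1%N. Qed.

Lemma f_inf_ge0 theta : 0 <= f_inf r theta.
Proof. exact: lb_le_inf (f_inf_nonempty theta) (@f_inf_lbound theta). Qed.

Lemma f_inf_le_pref m (P : 'I_r -> rel 'I_m) theta :
  (0 < m)%N -> preference_order P -> f_inf r theta <= f_pref P theta.
Proof.
move=> m0 hP; apply: (@le_trans _ _ (f_size r theta m)).
  by apply: ge_inf; [exists 0; exact: f_inf_lbound | exists m].
by apply: ge_inf; [exists 0; exact: f_size_lbound | exists P].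
Qed.

Lemma le_f_inf theta y :
  (forall m (P : 'I_r -> rel 'I_m), (0 < m)%N -> preference_order P ->
    y <= f_pref P theta) -> y <= f_inf r theta.
Proof.
move=> h; apply: (lb_le_inf (f_inf_nonempty theta)) => _ [m m0 <-].
apply: lb_le_inf => [|_ [P hP <-]]; last exact: h.
by have [P hP] := preference_order_exists m; exists (f_pref P theta), P.
Qed.

Lemma f_inf_le theta : 0 <= theta -> f_inf r theta <= f_inf r 0.
Proof.
move=> t0; apply: le_f_inf => m P m0 hP.
exact: le_trans (f_inf_le_pref theta m0 hP) (f_pref_le P t0).
Qed.

Lemma f_inf_eq theta :
  0 <= theta -> theta <= f_inf r 0 -> f_inf r theta = f_inf r 0.
Proof.
move=> t0 tf; apply/eqP; rewrite eq_le f_inf_le//=.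
apply: le_f_inf => m P m0 hP.
rewrite f_pref_eq//; first exact: f_inf_le_pref.
exact: le_trans tf (f_inf_le_pref 0 m0 hP).
Qed.

Lemma beta_bounds alpha : 0 < alpha <= 1 -> 0 <= beta r alpha <= f_inf r 0.
Proof.
move=> /andP[a0 a1].
have B0 : [set theta : R |
    0 <= theta <= r%:R^-1 /\ theta `^ alpha <= f_inf r theta] 0.
  by split; [rewrite lexx invr_ge0 /= | rewrite powR0 ?gt_eqF// f_inf_ge0].
apply/andP; split.
  by apply: ub_le_sup => //; exists r%:R^-1 => y [] /andP[_ ->].
apply: ge_sup; first by exists 0.
move=> y [] /andP[y0 y1] yf; apply: le_trans (f_inf_le y0).
apply: le_trans yf; move: y0; rewrite le_eqVlt => /predU1P[<-|y0].
  exact: powR_ge0.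
apply: ger1_powR => //; rewrite y0 (le_trans y1)// invf_le1 ?ltr0n ?ler1n.
  exact: ltnW.
exact: ltnW.
Qed.

Lemma g_constant alpha : 0 < alpha <= 1 -> g r alpha = g0 R r.
Proof.
suff gE (a : R) : 0 < a <= 1 -> g r a = - 1 / logb r%:R (f_inf r 0).
  by move=> a01; rewrite /g0 !gE// ltr01 lexx.
by move=> a01; have /andP[b0 bf] := beta_bounds a01; rewrite /g f_inf_eq.
Qed.

End Constancy.

(* Main.v *)
Require Import Defs.
From mathcomp Require Import all_boot all_order all_algebra.
From mathcomp Require Import all_classical all_reals all_analysis.
From mathcomp Require Import lra zify.
Import Order.TTheory GRing.Theory Num.Theory.
Local Open Scope ring_scope.

Set Implicit Arguments.
Unset Strict Implicit.
Unset Printing Implicit Defensive.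

(* Write f = f(r,0); it lies strictly between 0 and 1.  Fix a preference order P
   on m groups of colours with f_P(0) = y so close to f that d y^l is a negative
   power of d, split the palette evenly into m groups, and fix a large s.  A
   vertex of V_i is assigned the group highest in <_i among those containing at
   least s colours of its list.  If this is the group k, then all but at most
   m s colours of the list lie in groups weakly below k, which has probability
   at most polylog(d) x_i^l with x_i = rpos_{<_i}(k).  Hence the other vertices
   of a given edge at v in V_{i_x} can all be in the group k with probability
   at most polylog(d) y^l.  By simplicity the edges at v behave independently,
   so with s large enough a union bound over at most r d^M vertices shows that
   no such v has s or more of these dangerous edges.  Then v can avoid
   the colours already used on them, as it has s colours to choose from. *)

(** * Ranks in total orders and counting inequalities *)

Lemma total_rank m (le : rel 'I_m) j k : transitive le -> total le ->
  le j k = (#|[pred i | le i j]| <= #|[pred i | le i k]|)%N.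
Proof.
move=> tr tot; apply/idP/idP => [jk|].
  by apply/subset_leq_card/fintype.subsetP => i; rewrite !inE => /tr; apply.
apply: contraLR => njk; rewrite -ltnNge; apply: proper_card.
have kj : le k j by move: (tot j k); rewrite (negbTE njk).
apply/fintype.properP; split; first by apply/fintype.subsetP => i; rewrite !inE => /tr; apply.
by exists j; rewrite !inE ?njk //; move: (tot j j); rewrite orbb.
Qed.

(** The set lies in the down-set of its highest element, and the rank of that element already
    satisfies the bound. *)
Lemma card_low_rank m (le : rel 'I_m) (c : nat) : transitive le -> total le ->
  (#|[pred k | #|[pred j | le j k]| * c <= m]| * c <= m)%N.
Proof.
move=> tr tot; set A := [pred k | _].
have [/existsP[k0 k0A]|/existsPn A0] := boolP [exists k, A k]; last first.
  by rewrite (eq_card0 (A := A)) // => k; apply/negbTE/A0.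
case: (arg_maxnP (fun k => #|[pred j | le j k]|) k0A) => k kA kmax.
apply: leq_trans kA; rewrite leq_mul2r; apply/orP; right.
apply/subset_leq_card/fintype.subsetP => j jA.
by rewrite inE (total_rank _ _ tr tot); apply: kmax.
Qed.

Lemma card_bigcup_le (I T : finType) (D : pred I) (F : I -> {set T}) :
  (#|\bigcup_(i | D i) F i| <= \sum_(i | D i) #|F i|)%N.
Proof.
elim/big_ind2: _ => [|A a B b Aa Bb|//]; first by rewrite cards0.
rewrite cardsU; apply: leq_trans (leq_subr _ _) _; exact: leq_add.
Qed.

Lemma exists_subset_card (T : finType) (A : {set T}) j : (j <= #|A|)%N ->
  exists2 S : {set T}, S \subset A & #|S| = j.
Proof.
move=> /card_geqP[s [us <- sA]]; exists [set x in s].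
  by apply/fintype.subsetP => x; rewrite inE => /sA.
by rewrite cardsE; apply/card_uniqP.
Qed.

(** Factor by factor this is [(a - i) * t <= a * (t - i)]; once [i] reaches [a], truncated
    subtraction makes the left side zero. *)
Lemma ffact_ratio a t j : (a <= t)%N -> (a ^_ j * t ^ j <= a ^ j * t ^_ j)%N.
Proof.
move=> le_at; elim: j => [|j IH]; first by rewrite !ffactn0 !expn0.
rewrite !ffactnSr !expnSr mulnACA [leqRHS]mulnACA leq_mul //.
have [lt_aj|le_ja] := ltnP a j; first by rewrite (eqP (ltnW lt_aj)).
by rewrite mulnBl mulnBr; apply: leq_sub2l; rewrite mulnC leq_mul2l le_at orbT.
Qed.

Lemma bin_ratio a t j : (a <= t)%N -> ('C(a, j) * t ^ j <= a ^ j * 'C(t, j))%N.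
Proof.
move=> /(ffact_ratio j) le_ffact.
by rewrite -(leq_pmul2r (fact_gt0 j)) mulnAC bin_ffact -mulnA bin_ffact.
Qed.

Lemma bin_le_exp n j : ('C(n, j) <= n ^ j)%N.
Proof.
apply: leq_trans (_ : n ^_ j <= _)%N.
  by rewrite -bin_ffact leq_pmulr // fact_gt0.
elim: j => [|j IH]; first by rewrite ffactn0 expn0.
by rewrite ffactnSr expnSr leq_mul // leq_subr.
Qed.

(** Both sides count the [l]-subsets of a [t]-set with a marked [j]-subset. Multiplied by the
    factorials of [j], [l - j] and [t - l], each becomes the factorial of [t]. *)
Lemma mul_bin_trinomial t l j : (j <= l <= t)%N ->
  ('C(t, j) * 'C(t - j, l - j) = 'C(t, l) * 'C(l, j))%N.
Proof.
move=> /andP[jl lt].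
have jt := leq_trans jl lt.
have lt' : (l - j <= t - j)%N by rewrite leq_sub2r.
have e1 := bin_fact jt; have e2 := bin_fact lt'.
have e3 := bin_fact lt; have e4 := bin_fact jl.
have sub : (t - j - (l - j) = t - l)%N by rewrite subnBA // subnK.
rewrite sub in e2.
have p0 : (0 < j`! * ((l - j)`! * (t - l)`!))%N by rewrite !muln_gt0 !fact_gt0.
apply/eqP; rewrite -(eqn_pmul2r p0); apply/eqP.
rewrite mulnACA e2 -mulnA e1 -mulnA (mulnA j`!) (mulnA 'C(l, j)) e4 e3 //.
Qed.

(** * Bounds on the constant f(r,0) and its relation to g(r,0) *)

Section Constant.
Variables (R : realType) (r : nat).
(** Each order puts at most [m / (r + 1)] groups at relative position [1 / (r + 1)] or lower, so the
    [r] orders together exclude fewer than [m] groups. *)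
Lemma exists_high_rank m (P : 'I_r -> rel 'I_m) : (0 < m)%N ->
  preference_order P -> exists k, forall i, r.+1%:R^-1 <= rpos R (P i) k.
Proof.
move=> m0 hP; apply: contrapT => no.
have cover : [pred k : 'I_m | true] \subset
    \bigcup_(i : 'I_r) [set k | #|[pred j | P i j k]| * r.+1 <= m]%N.
  apply/fintype.subsetP => k _; apply: contrapT => /negP kn; apply: no; exists k => i.
  rewrite /rpos ler_pdivlMr ?ltr0n// mulrC ler_pdivrMr ?ltr0n//.
  rewrite -natrM ler_nat leqNgt; apply: contra kn => /ltnW lt.
  by apply/bigcupP; exists i; rewrite ?inE.
have := subset_leq_card cover; rewrite card_ord => le1.
have le2 := leq_trans le1 (card_bigcup_le _ _).
have : (m * r.+1 <= r * m)%N.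
  apply: (@leq_trans ((\sum_(i < r)
      #|[set k | (#|[pred j | P i j k]| * r.+1 <= m)%N]|) * r.+1)%N).
    by rewrite leq_mul2r; apply/orP; right.
  rewrite big_distrl /=; apply: (@leq_trans (\sum_(i < r) m)%N); last first.
    by rewrite sum_nat_const card_ord.
  apply: leq_sum => i _; rewrite cardsE.
  by have [_ tr tot] := hP i; apply: card_low_rank.
by rewrite mulnS mulnC; move: m0; lia.
Qed.

(** A group that is high in every order bounds [f_pref P 0] below by a constant free of [m], so
    positivity survives the infimum. *)
Lemma f_inf0_gt0 : 0 < f_inf r (0 : R).
Proof.
have c0 : 0 < r.+1%:R^-1 :> R by rewrite invr_gt0 ltr0n.
apply: (@lt_le_trans _ _ (r.+1%:R^-1 ^+ r)); first exact: exprn_gt0.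
apply: le_f_inf => m P m0 hP.
have [k kP] := exists_high_rank m0 hP.
apply: (@le_trans _ _ (prod_nonmax (fun i => rpos R (P i) k))); last first.
  apply: le_bigmax_cond; apply/forallP => i.
  by rewrite rpos_ge0 rpos_le1.
apply: (@le_trans _ _ (\prod_(i < r | ~~ is_imax (fun i => rpos R (P i) k) i)
    r.+1%:R^-1)); last first.
  by apply: ler_prod => i _; rewrite kP ltW.
rewrite prodr_const; apply: ler_wiXn2l; first exact: ltW.
  by rewrite invf_le1 ?ltr0n// ler1n.
by rewrite -[leqRHS]card_ord max_card.
Qed.

Hypothesis r_ge2 : (2 <= r)%N.

(** Take two groups, ordered one way in the first class and the opposite way in all others. Each
    group is at the bottom of some order, with relative position 1/2, and the product is at most any
    single coordinate. *)
Lemma f_inf0_lt1 : f_inf r (0 : R) < 1.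
Proof.
pose i0 : 'I_r := Ordinal (ltnW r_ge2); pose i1 : 'I_r := Ordinal r_ge2.
pose P (i : 'I_r) : rel 'I_2 :=
  fun j k => if i == i0 then (j <= k)%N else (k <= j)%N.
have hP : preference_order P.
  move=> i; rewrite /P; case: (i == i0); split.
  - by move=> j k jk; apply/val_inj/anti_leq.
  - by move=> j k h; apply: leq_trans.
  - by move=> j k; apply: leq_total.
  - by move=> j k jk; apply/val_inj/anti_leq; rewrite andbC.
  - by move=> j k h /[swap]; apply: leq_trans.
  - by move=> j k; apply: leq_total.
apply: (@le_lt_trans _ _ (2^-1)); last lra.
apply: le_trans (f_inf_le_pref 0 _ hP) _ => //.
apply/bigmax_leP; split=> [|k _]; first by lra.
have x01 j : 0 <= rpos R (P j) k <= 1 by rewrite rpos_ge0 rpos_le1.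
apply: le_trans (prod_nonmax_le r_ge2 (if k == ord0 then i0 else i1) x01) _.
rewrite /rpos; suff -> : #|[pred j | P (if k == ord0 then i0 else i1) j k]| = 1%N.
  by rewrite mul1r lexx.
rewrite -sum1_card big_mkcond !big_ord_recl big_ord0 /= !inE /P.
by case: k {x01} => -[|[|//]] /= lt.
Qed.

Lemma is_imax_uniq (x : 'I_r -> R) i j : is_imax x i -> is_imax x j -> i = j.
Proof.
move=> /andP[i1 /forallP i2] /andP[j1 /forallP j2].
apply/val_inj/anti_leq; have := i2 j; have := j2 i.
by rewrite i1 j1 /= => -> ->.
Qed.

Lemma prod_nonmaxE (x : 'I_r -> R) i : is_imax x i ->
  prod_nonmax x = \prod_(j | j != i) x j.
Proof.
move=> ix; apply: eq_bigl => j; congr (~~ _).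
apply/idP/eqP => [jx|-> //]; exact: is_imax_uniq jx ix.
Qed.

(** [beta r 1] lies in the range where f(r, theta) still equals f(r,0). The list length thus becomes
    [(1 + eps) * ln d / a] with [a = - ln f]. *)
Lemma g0E : g0 R r = ln r%:R / - ln (f_inf r (0 : R)).
Proof.
have /andP[b0 bf] : 0 <= beta r (1 : R) <= f_inf r (0 : R).
  by apply: beta_bounds => //; rewrite ltr01 lexx.
by rewrite /g0 /g f_inf_eq // /logb invf_div mulN1r invrN mulrN.
Qed.

End Constant.

(** * Random lists: independence, union bounds and tails *)

Section Lists.
Variables (R : realType) (V C : finType) (l : nat).
Hypothesis l_le : (l <= #|C|)%N.
Local Notation w := (@unif_subset R C l).
Local Notation Pr := (@prob_lists R V C l).
Implicit Types Q : pred {ffun V -> {set C}}.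

Lemma unif_subset_ge0 A : 0 <= w A.
Proof. by rewrite /unif_subset; case: ifP => // _; rewrite invr_ge0. Qed.

Lemma sum_unif_subset (B : pred {set C}) :
  \sum_(A | B A) w A = #|[set A | B A & #|A| == l]|%:R / 'C(#|C|, l)%:R.
Proof.
rewrite /unif_subset -big_mkcondr /= sumr_const -[LHS]mulr_natl.
by congr (_ * _); apply: (congr1 (GRing.natmul 1)); apply: eq_card => A; rewrite inE.
Qed.

Lemma sum_unif_subsetT : \sum_A w A = 1.
Proof.
rewrite sum_unif_subset /= card_draws divff // pnatr_eq0 -lt0n.
by rewrite bin_gt0.
Qed.

Lemma prob_lists_prod (B : V -> pred {set C}) :
  Pr (fun L => [forall v, B v (L v)]) = \prod_v \sum_(A | B v A) w A.
Proof.
rewrite bigA_distr_big_dep /=; apply: eq_bigl => L.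
by apply/forallP/familyP => h v; have := h v; rewrite ?inE.
Qed.

Lemma prob_lists_in (U : {set V}) (B : V -> pred {set C}) :
  Pr (fun L => [forall v in U, B v (L v)]) = \prod_(v in U) \sum_(A | B v A) w A.
Proof.
rewrite (prob_lists_prod (fun v A => (v \in U) ==> B v A)).
rewrite [RHS]big_mkcond; apply: eq_bigr => v _.
by case: ifP => vU //=; rewrite sum_unif_subsetT.
Qed.

Lemma prod_unif_ge0 (L : {ffun V -> {set C}}) : 0 <= \prod_v w (L v).
Proof. by apply: prodr_ge0 => v _; apply: unif_subset_ge0. Qed.

Lemma prob_listsT : Pr predT = 1.
Proof.
have := prob_lists_prod (fun _ _ => true).
rewrite big1 => [<-|v _]; last exact: sum_unif_subsetT.
by apply: eq_bigl => L; apply/esym/forallP.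
Qed.

(** This is the union bound. The covering is asked only of lists of size [l], because every other
    assignment has weight zero. *)
Lemma prob_lists_bigcup (I : finType) (D : pred I)
    (Q_ : I -> pred {ffun V -> {set C}}) Q :
  (forall L : {ffun V -> {set C}}, (forall v, #|L v| = l) -> Q L -> exists2 i, D i & Q_ i L) ->
  Pr Q <= \sum_(i | D i) Pr (Q_ i).
Proof.
move=> QQ; rewrite /prob_lists.
under [leRHS]eq_bigr do rewrite big_mkcond.
rewrite exchange_big /= big_mkcond; apply: ler_sum => L _.
have ge0 (b : bool) : 0 <= if b then \prod_v w (L v) else 0.
  by case: b => //; exact: prod_unif_ge0.
case: ifP => QL; last by apply: sumr_ge0 => i _; exact: ge0.
have [/forallP Ll|/forallPn[v Lv]] := boolP [forall v, #|L v| == l].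
  have [i Di Qi] := QQ L (fun v => eqP (Ll v)) QL.
  by rewrite (bigD1 i) //= Qi lerDl sumr_ge0 // => j _; exact: ge0.
have {1}-> : \prod_v w (L v) = 0.
  by rewrite (bigD1 v) //= {1}/unif_subset (negbTE Lv) mul0r.
by apply: sumr_ge0 => i _; exact: ge0.
Qed.

(** Deleting [S] injects these sets into the subsets of its complement of size [l - #|S|]. *)
Lemma card_supersets (S : {set C}) :
  (#|[set A : {set C} | S \subset A & #|A| == l]| <= 'C(#|C| - #|S|, l - #|S|))%N.
Proof.
have -> : (#|C| - #|S|)%N = #|~: S| by rewrite -(cardsC S) addKn.
rewrite -cards_draws -(card_in_imset (f := fun A => A :\: S)).
  apply/subset_leq_card/fintype.subsetP => _ /imsetP[A + ->].
  rewrite !inE => /andP[SA /eqP Al]; rewrite cardsD (finset.setIidPr SA) Al eqxx andbT.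
  by apply/fintype.subsetP => x; rewrite !inE => /andP[].
move=> A B; rewrite !inE => /andP[/finset.setIidPr SA _] /andP[/finset.setIidPr SB _] eAB.
by rewrite -(finset.setID A S) -(finset.setID B S) SA SB eAB.
Qed.

(* If at most q elements of A lie outside D then A contains one of the
   (l - q)-subsets of D; this is the union bound over these subsets. *)
Lemma unif_subset_tail (D : {set C}) q : (q <= l)%N ->
  \sum_(A : {set C} | (#|A :\: D| <= q)%N) w A
    <= 'C(l, q)%:R * (#|D|%:R / #|C|%:R) ^+ (l - q).
Proof.
move=> ql; rewrite sum_unif_subset; set N := #|_|.
have leN : (N <= 'C(#|D|, l - q) * 'C(#|C| - (l - q), q))%N.
  rewrite -cards_draws -sum_nat_const.
  apply: leq_trans (_ :
    #|\bigcup_(S in [set S : {set C} | S \subset D & #|S| == l - q]%N)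
      [set A : {set C} | S \subset A & #|A| == l]| <= _)%N.
    apply/subset_leq_card/fintype.subsetP => A; rewrite inE => /andP[Aq Al].
    have : (l - q <= #|A :&: D|)%N.
      by rewrite -(eqP Al) -(cardsID D A) leq_subLR addnC leq_add2r.
    move=> /exists_subset_card[S SAD Sl]; apply/bigcupP; exists S.
      by rewrite inE Sl eqxx andbT (fintype.subset_trans SAD (finset.subsetIr _ _)).
    by rewrite inE Al andbT (fintype.subset_trans SAD (finset.subsetIl _ _)).
  apply: leq_trans (card_bigcup_le _ _) _; apply: leq_sum => S.
  rewrite inE => /andP[_ /eqP Sl]; apply: leq_trans (card_supersets S) _.
  by rewrite Sl subKn.
have [C0|C0] := posnP #|C|.
  have l0 : l = 0%N by apply/eqP; rewrite -leqn0 -C0.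
  have q0 : q = 0%N by apply/eqP; rewrite -leqn0 -l0.
  move: leN; rewrite l0 q0 C0 !bin0 expr0 mulr1 divr1 ler_nat; exact.
rewrite expr_div_n mulrA ler_pdivrMr ?ltr0n ?bin_gt0 // mulrAC.
rewrite ler_pdivlMr ?exprn_gt0 ?ltr0n // -!natrX -!natrM ler_nat.
(* [bin_ratio] trades the binomial of [#|D|] for that of [#|C|]; the trinomial identity then turns
   the product into ['C(#|C|, l) * 'C(l, q)], cancelling the denominator. *)
apply: leq_trans (leq_mul leN (leqnn _)) _.
rewrite mulnAC; apply: leq_trans (leq_mul (bin_ratio _ (max_card D)) (leqnn _)) _.
have : ((l - q <= l) && (l <= #|C|))%N by rewrite leq_subr.
move=> /mul_bin_trinomial; rewrite subKn // bin_sub // => tri.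
by rewrite -mulnA tri mulnCA mulnC (mulnC (_ ^ _)%N).
Qed.

Lemma prob_listsC Q : Pr Q = 1 - Pr (predC Q).
Proof. by apply/eqP; rewrite -prob_listsT /prob_lists [X in _ == X - _](bigID Q) addrK. Qed.

(** There are at most [#|F| ^ s] ways to choose [s] members of [F]. Being disjoint, they involve
    independent lists, so each choice has probability at most [p ^+ s]. *)
Lemma prob_many_le (B : V -> pred {set C}) (F : {set {set V}}) s p :
  finset.trivIset F -> 0 <= p ->
  (forall f, f \in F -> \prod_(u in f) \sum_(A | B u A) w A <= p) ->
  Pr (fun L => s <= #|[set f in F | [forall u in f, B u (L u)]]|)%N
    <= (#|F|%:R * p) ^+ s.
Proof.
move=> trivF p0 Fp.
pose D := [pred S : {set {set V}} | (S \subset F) && (#|S| == s)].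
pose Q_ (S : {set {set V}}) (L : {ffun V -> {set C}}) :=
  [forall u in finset.cover S, B u (L u)].
apply: le_trans; first apply: (prob_lists_bigcup (D := D) (Q_ := Q_)).
  move=> L _ /exists_subset_card[S SF Ss]; exists S.
    rewrite inE Ss eqxx andbT; apply: fintype.subset_trans SF _.
    by apply/fintype.subsetP => f; rewrite inE => /andP[].
  apply/forall_inP => u /bigcupP[f fS uf].
  move: (fintype.subsetP SF f fS); rewrite inE => /andP[_ /forall_inP]; exact.
apply: (@le_trans _ _
    (\sum_(S in [set S : {set {set V}} | S \subset F & #|S| == s]) p ^+ s)).
  rewrite [leRHS](eq_bigl D); last first.
    by move=> S; rewrite inE.
  apply: ler_sum => S /andP[SF /eqP Ss].
  rewrite prob_lists_in finset.big_trivIset; last exact: trivIsetS trivF.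
  rewrite -Ss -prodr_const; apply: ler_prod => f fS.
  rewrite Fp ?(fintype.subsetP SF) // andbT; apply: prodr_ge0 => u _.
  by apply: sumr_ge0 => A _; exact: unif_subset_ge0.
rewrite sumr_const cards_draws -[leLHS]mulr_natl exprMn -natrX.
by rewrite ler_wpM2r ?exprn_ge0 // ler_nat bin_le_exp.
Qed.

End Lists.

(** * Edges at a vertex, and the deterministic colouring *)

Section Stars.
Variables (V : finType) (r d : nat) (part : V -> 'I_r) (E : {set {set V}}).
Hypothesis partE : partite part E.

(** Removing [v] makes the members pairwise disjoint when the hypergraph is simple, which is what
    gives independence. *)
Definition star v := [set e :\ v | e in [set e in E | v \in e]].

Lemma partite_inj e : e \in E -> {in e &, injective part}.
Proof.
move=> eE u v ue ve uv; have := partE eE (part v).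
move=> /eqP; rewrite eqn_leq => /andP[/card_le1_eqP h _].
by apply: h; rewrite !inE ?ue ?ve ?uv ?eqxx.
Qed.

Lemma partite_exists e i : e \in E -> exists2 v, v \in e & part v = i.
Proof.
move=> eE; have : (0 < #|[pred v in e | part v == i]|)%N by rewrite partE.
by move=> /card_gt0P[v]; rewrite inE => /andP[ve /eqP vi]; exists v.
Qed.

Lemma trivIset_star v : simple E -> finset.trivIset (star v).
Proof.
move=> simpE; apply/finset.trivIsetP => _ _ /imsetP[e1 + ->] /imsetP[e2 + ->].
rewrite !inE => /andP[e1E ve1] /andP[e2E ve2] ne.
have ne12 : e1 != e2 by apply: contra ne => /eqP ->.
have /card_le1_eqP h := simpE _ _ e1E e2E ne12.
rewrite -setI_eq0; apply/eqP/setP => u; rewrite !inE; apply/negbTE/negP.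
move=> /andP[/andP[uv ue1] /andP[_ ue2]]; move/eqP: uv; apply.
by apply: h; rewrite inE ?ue1 ?ve1.
Qed.

Lemma card_star v : regular d E -> (#|star v| <= d)%N.
Proof.
by move=> regE; apply: leq_trans (leq_imset_card _ _) _; rewrite cardsE regE.
Qed.

(** An edge at [v] without [v] meets every class other than that of [v] exactly once. *)
Lemma prod_star (R : comNzRingType) (F : 'I_r -> R) v f : f \in star v ->
  \prod_(u in f) F (part u) = \prod_(i | i != part v) F i.
Proof.
move=> /imsetP[e]; rewrite inE => /andP[eE ve] ->.
rewrite (partition_big part (fun i => i != part v)) /=; last first.
  move=> u; rewrite !inE => /andP[uv ue]; apply: contra uv => /eqP.
  by move/(partite_inj eE ue ve) ->.
apply: eq_bigr => i iv; have [u ue ui] := partite_exists i eE.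
rewrite (big_pred1 u) ?ui // => u'; rewrite !inE.
apply/idP/eqP => [/andP[/andP[_ u'e] /eqP u'i]|->].
  by apply: (partite_inj eE) => //; rewrite u'i.
by rewrite ue ui eqxx !andbT; apply: contra iv => /eqP <-; rewrite ui.
Qed.

(* Every vertex v picks a colour of the group [top v]; it has at least s of
   them.  Only the vertices in the class [ix k] of a group k have to avoid a
   monochromatic edge of a colour in k, and each of them has fewer than s edges
   whose other vertices could all belong to the group k. *)
Lemma chooseable_of_groups (C : finType) (m s : nat) (L : {ffun V -> {set C}})
    (gr : C -> 'I_m) (ix : 'I_m -> 'I_r) (top : V -> 'I_m)
    (B : V -> 'I_m -> bool) : (2 <= r)%N ->
  (forall v, s <= #|[set c in L v | gr c == top v]|)%N ->
  (forall v, B v (top v)) ->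
  (forall v k, part v = ix k ->
    #|[set f in star v | [forall u in f, B u k]]| < s)%N ->
  (0 < s)%N -> chooseable E L.
Proof.
move=> r2 many Btop few s0.
(* [c0] is a default colour, kept by every vertex that is not in the class responsible for its
   group. *)
have /fin_all_exists[c0 c0P] v : exists c, c \in [set c in L v | gr c == top v].
  by apply/card_gt0P; apply: leq_trans (many v).
pose bad v := [set f in star v | [forall u in f, B u (top v)]].
(* One forbidden colour per dangerous edge suffices: the default colour of an arbitrary other vertex
   of it. The fallback [v] concerns only an empty [f]. *)
pose forb v := [set c0 (odflt v [pick u in f]) | f : {set V} in bad v].
have /fin_all_exists[c cP] v : exists c, c \in [set c in L v | gr c == top v] /\
    if part v == ix (top v) then c \notin forb v : Prop else c = c0 v.
  case: eqP => [vk|_]; last by exists (c0 v).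
  have : (0 < #|[set c in L v | gr c == top v] :\: forb v|)%N.
    rewrite cardsD subn_gt0; apply: leq_trans (many v).
    apply: leq_ltn_trans (few _ _ vk); apply: leq_trans (leq_imset_card _ _).
    by apply/subset_leq_card/finset.subsetIr.
  by move=> /card_gt0P[x]; rewrite !finset.in_setD => /andP[]; exists x.
have cL v : c v \in L v by have [] := cP v; rewrite inE => /andP[].
have cgr v : gr (c v) = top v by have [] := cP v; rewrite inE => /andP[_ /eqP].
apply/existsP; exists (finfun c); apply/andP; split.
  by apply/forallP => v; rewrite ffunE.
apply/forall_inP => e eE; apply/existsPn => a; apply/negP => /forall_inP ca.
have {}ca u : u \in e -> c u = a by move=> /ca; rewrite ffunE => /eqP.
have top_e u : u \in e -> top u = gr a by move=> /ca <-.
have [v ve vi] := partite_exists (ix (gr a)) eE.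
(* A second class, available as [r >= 2], shows that [e :\ v] is nonempty. *)
have [i iv] : exists i, i != part v.
  have : (0 < #|predC1 (part v)|)%N by rewrite cardC1 card_ord; case: r r2 => [|[]].
  by move=> /card_gt0P[i]; rewrite !inE => ?; exists i.
have ev_bad : e :\ v \in bad v.
  rewrite inE; apply/andP; split.
    by apply/imsetP; exists e; rewrite // inE eE ve.
  apply/forall_inP => u; rewrite !inE top_e // => /andP[_ ue].
  by rewrite -(top_e u ue).
have [_] := cP v; rewrite top_e // vi eqxx => /negP; apply.
apply/imsetP; exists (e :\ v) => //; rewrite ca //.
case: pickP => [u|none] /=; last first.
  have [u ue ui] := partite_exists i eE; have := none u.
  rewrite !inE ue andbT => /negbFE/eqP uv; move: iv.
  by rewrite -ui uv eqxx.
rewrite !inE => /andP[uv ue].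
(* [u] is outside the responsible class, so it kept [c0 u]; hence [a] is exactly the colour
   forbidden at [v]. *)
have [_] := cP u; rewrite top_e // -vi; case: eqP => [|_ <-]; last by rewrite ca.
by move=> /(partite_inj eE ue ve) uv'; rewrite uv' eqxx in uv.
Qed.

End Stars.

(** * Colour groups and the tail estimate for one list *)

Section Groups.
Variables (C : finType) (m : nat) (gr : C -> 'I_m) (le : rel 'I_m).
Hypotheses (le_trans : transitive le) (le_total : total le).

Definition down_set k := [set c | le (gr c) k].

(** Take the highest group with at least [s] colours in [A]; one exists since [A] has more than
    [m * s] elements. The colours outside its down-set lie in at most [m] groups, each contributing
    fewer than [s]. *)
Lemma exists_top_group (A : {set C}) s : (m * s < #|A|)%N ->
  exists k, (s <= #|[set c in A | gr c == k]|)%N /\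
    (#|A :\: down_set k| <= m * s)%N.
Proof.
move=> Abig; pose heavy k := (s <= #|[set c in A | gr c == k]|)%N.
have light_le (B : {set C}) : (forall c, c \in B -> c \in A /\ ~~ heavy (gr c)) ->
    (#|B| <= m * s)%N.
  move=> Bl; apply: leq_trans
    (_ : #|\bigcup_(k | ~~ heavy k) [set c in A | gr c == k]| <= _)%N.
    apply/subset_leq_card/fintype.subsetP => c /Bl[cA cl].
    by apply/bigcupP; exists (gr c) => //; rewrite inE cA eqxx.
  apply: leq_trans (card_bigcup_le _ _) _.
  apply: leq_trans (_ : \sum_(k < m) s <= _)%N; last first.
    by rewrite sum_nat_const card_ord.
  rewrite big_mkcond; apply: leq_sum => k _; case: ifP => //.
  by rewrite -ltnNge => /ltnW.
have [k0 k0h] : exists k, heavy k.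
  apply: contrapT => none; move: Abig; rewrite ltnNge light_le // => c cA.
  by split=> //; apply/negP => h; apply: none; exists (gr c).
case: (arg_maxnP (fun k => #|[pred j | le j k]|) k0h) => k kh kmax.
exists k; split=> //; apply: light_le => c; rewrite !inE => /andP[ncD cA].
split=> //; apply: contra ncD => /kmax; rewrite /= -total_rank //.
Qed.

Variables (R : realType) (l : nat).
Hypothesis card_gr : forall k, (#|[set c | gr c == k]| * m <= #|C| + m)%N.
Hypotheses (l_gt0 : (0 < l)%N) (l_le : (l <= #|C|)%N).

(** The factor [1 + m / #|C|] pays for rounding: a group may have up to [#|C| / m + 1] colours. *)
Lemma card_down_set k :
  #|down_set k|%:R / #|C|%:R <= rpos R le k * (1 + m%:R / #|C|%:R).
Proof.
have C0 : 0 < #|C|%:R :> R by rewrite ltr0n; exact: leq_trans l_le.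
have m0 : 0 < m%:R :> R by rewrite ltr0n; exact: leq_trans (ltn_ord k).
have : (#|down_set k| * m <= #|[pred j | le j k]| * (#|C| + m))%N.
  apply: leq_trans (_ : (\sum_(j | le j k) #|[set c | gr c == j]|) * m <= _)%N.
    rewrite leq_mul2r; apply/orP; right.
    apply: leq_trans (card_bigcup_le _ _).
    apply/subset_leq_card/fintype.subsetP => c; rewrite inE => cd.
    by apply/bigcupP; exists (gr c); rewrite ?inE.
  by rewrite big_distrl -sum_nat_const; apply: leq_sum.
rewrite -(ler_nat R) !natrM natrD => h.
rewrite ler_pdivrMr // /rpos -mulrA mulrDl mul1r divfK ?gt_eqF //.
by rewrite mulrAC ler_pdivlMr.
Qed.

Lemma rpos_ge_inv k : m%:R^-1 <= rpos R le k.
Proof.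
rewrite /rpos ler_peMl ?invr_ge0 // ler1n; apply/card_gt0P; exists k.
by rewrite inE; move: (le_total k k); rewrite orbb.
Qed.

(** With [x = rpos R le k], three estimates combine: ['C(l, q) <= l ^ q]; the rounding factor to the
    power [l - q] is at most [expR m], as [l <= #|C|]; and [x >= 1 / m] gives
    [x ^ (l - q) <= m ^ q * x ^ l]. *)
Lemma down_set_tail k q : (q <= l)%N ->
  \sum_(A : {set C} | (#|A :\: down_set k| <= q)%N) unif_subset R l A
    <= (l * m)%:R ^+ q * expR m%:R * rpos R le k ^+ l.
Proof.
move=> ql; apply: Order.le_trans (unif_subset_tail R l_le _ ql) _.
have C0 : 0 < #|C|%:R :> R by rewrite ltr0n; exact: leq_trans l_le.
have m0 : 0 < m%:R :> R by rewrite ltr0n; exact: leq_trans (ltn_ord k).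
have x0 := rpos_ge0 R le k.
rewrite natrM [(l%:R * _) ^+ q]exprMn -!mulrA; apply: ler_pM; rewrite ?ler0n //.
- by rewrite -natrX ler_nat bin_le_exp.
apply: Order.le_trans (_ : (rpos R le k * (1 + m%:R / #|C|%:R)) ^+ (l - q) <= _).
  apply: lerXn2r; rewrite ?nnegrE ?divr_ge0 ?card_down_set //.
  by rewrite mulr_ge0 // addr_ge0 // divr_ge0.
rewrite exprMn mulrC mulrCA; apply: ler_pM.
- by rewrite exprn_ge0 // addr_ge0 // divr_ge0.
- exact: exprn_ge0.
- apply: Order.le_trans (_ : (1 + m%:R / #|C|%:R) ^+ #|C| <= _).
    apply: ler_weXn2l; first by rewrite lerDl divr_ge0.
    exact: leq_trans (leq_subr _ _) l_le.
  apply: Order.le_trans (_ : expR (m%:R / #|C|%:R) ^+ #|C| <= _).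
    apply: lerXn2r; rewrite ?nnegrE ?expR_ge0 ?addr_ge0 ?divr_ge0 //.
    exact: expR_ge1Dx.
  by rewrite -expRM_natl mulrC divfK // gt_eqF.
rewrite -{2}(subnK ql) exprD mulrCA -exprMn ler_peMr ?exprn_ge0 //.
by rewrite exprn_ege1 // mulrC -ler_pdivrMr // mul1r rpos_ge_inv.
Qed.

End Groups.

(** * Grouping colours by residue, and the union bound over vertices and groups *)

Lemma card_residue t m (m0 : (0 < m)%N) (k : 'I_m) :
  (#|[set c : 'I_t | Ordinal (ltn_pmod c m0) == k]| * m <= #|{: 'I_t}| + m)%N.
Proof.
rewrite card_ord; set G := [set c | _].
(* Within a residue class a colour is determined by its quotient, which takes at most [t %/ m + 1]
   values. *)
have quo_lt (c : 'I_t) : (c %/ m < (t %/ m).+1)%N.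
  by rewrite ltnS leq_div2r // ltnW.
have : (#|G| <= (t %/ m).+1)%N.
  rewrite -[leqRHS]card_ord -(card_in_imset (f := fun c => Ordinal (quo_lt c))).
    exact: max_card.
  move=> c c'; rewrite !inE => /eqP/(congr1 val)/= ck /eqP/(congr1 val)/= c'k [qq].
  by apply/val_inj; rewrite /= (divn_eq c m) (divn_eq c' m) qq ck c'k.
move=> /(leq_mul (leqnn m)); rewrite mulnC => /leq_trans; apply.
by rewrite mulnC mulSn addnC leq_add2r leq_divM.
Qed.

Lemma exists_imax (R : realType) r (x : 'I_r -> R) : (0 < r)%N ->
  exists i, is_imax x i.
Proof.
move=> r0; have [i1 _ i1max] := Order.TotalTheory.arg_maxP x (isT : predT (Ordinal r0)).
have max1 : [forall j, x j <= x i1] by apply/forallP => j; exact: i1max.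
case: (arg_minnP (fun i : 'I_r => nat_of_ord i)
  (max1 : (fun i => [forall j, x j <= x i]) i1)) => i iP imin.
exists i; rewrite /is_imax iP; apply/forallP => j.
by apply/implyP => /imin.
Qed.

(** A failure yields a group [k] and a vertex [v] in the class [ix k] with at least [s] dangerous
    edges. There are at most [r * n * m] such pairs, and [p] bounds the probability that a given
    edge at [v] is dangerous. *)
Lemma prob_not_chooseable (R : realType) (r m n d l t s : nat)
    (P : 'I_r -> rel 'I_m) (y : R) (V : finType) (part : V -> 'I_r)
    (E : {set {set V}}) : (2 <= r)%N -> (0 < m)%N -> preference_order P ->
  f_pref P 0 <= y -> (0 < s)%N -> (m * s < l)%N -> (l <= t)%N ->
  classes_of_size n part -> partite part E -> simple E -> regular d E ->
  prob_lists R l (fun L : {ffun V -> {set 'I_t}} => ~~ chooseable E L)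
    <= (r * n * m)%:R *
      (d%:R * (((l * m)%:R ^+ (m * s) * expR m%:R) ^+ r * y ^+ l)) ^+ s.
Proof.
move=> r2 m0 hP fy s0 msl lt sizeV partE simpE regE.
have l0 : (0 < l)%N by exact: leq_ltn_trans msl.
pose x k i := rpos R (P i) k.
have /fin_all_exists[ix ixP] k : exists i, is_imax (x k) i.
  by apply: exists_imax; exact: ltnW.
pose gr (c : 'I_t) := Ordinal (ltn_pmod c m0).
pose B (v : V) k (A : {set 'I_t}) :=
  (#|A :\: down_set gr (P (part v)) k| <= m * s)%N.
set b := _ * expR _; set p := b ^+ r * _.
have lC : (l <= #|{: 'I_t}|)%N by rewrite card_ord.
(* This allows the exponent of [b], the number of classes other than that of [v], to be raised to
   [r]. *)
have b1 : 1 <= b.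
  have e1 : 1 <= expR m%:R :> R by rewrite -expR0 ler_expR.
  have l1 : 1 <= (l * m)%:R ^+ (m * s) :> R.
    by rewrite exprn_ege1 // ler1n muln_gt0 l0.
  by rewrite -[1]mulr1; apply: ler_pM.
have b0 : 0 <= b := le_trans ler01 b1.
have y0 : 0 <= y := le_trans (f_pref_ge0 P (0 : R)) fy.
have p0 : 0 <= p by rewrite mulr_ge0 ?exprn_ge0.
have np0 k : 0 <= k%:R * p by rewrite mulr_ge0 // ler0n.
pose D (vk : V * 'I_m) := part vk.1 == ix vk.2.
pose bad (vk : V * 'I_m) (L : {ffun V -> {set 'I_t}}) :=
  (s <= #|[set f in star E vk.1 | [forall u in f, B u vk.2 (L u)]]|)%N.
apply: le_trans (_ : \sum_(vk | D vk) prob_lists R l (bad vk) <= _).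
  apply: prob_lists_bigcup => // L Ll; apply: contraNP => none.
  have /fin_all_exists[top topP] v : exists k,
      (s <= #|[set c in L v | gr c == k]|)%N /\ B v k (L v).
    have [_ tr tot] := hP (part v).
    by apply: exists_top_group => //; rewrite Ll.
  apply: (@chooseable_of_groups _ _ _ _ partE _ m s L gr ix top
    (fun v k => B v k (L v))) => //.
  - by move=> v; have [] := topP v.
  - by move=> v; have [] := topP v.
  - move=> v k vk; rewrite ltnNge; apply/negP => few; apply: none.
    by exists (v, k) => //; apply/eqP.
have badP vk : D vk -> prob_lists R l (bad vk) <= (d%:R * p) ^+ s.
  case: vk => v k /eqP /= vk.
  apply: le_trans (_ : (#|star E v|%:R * p) ^+ s <= _); last first.
    apply: lerXn2r; rewrite ?nnegrE ?np0 //.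
    by rewrite ler_wpM2r // ler_nat card_star.
  apply: (prob_many_le (B := fun u => B u k) lC _ _ p0); first exact: trivIset_star.
  move=> f fv.
  rewrite (prod_star partE (fun i => \sum_(A : {set 'I_t} |
    (#|A :\: down_set gr (P i) k| <= m * s)%N) unif_subset R l A) fv).
  apply: le_trans (_ : \prod_(i | i != part v) (b * x k i ^+ l) <= _).
    apply: ler_prod => i _; apply/andP; split.
      by apply: sumr_ge0 => A _; exact: unif_subset_ge0.
    have [_ tr tot] := hP i.
    by apply: down_set_tail => //; [exact: card_residue|exact: ltnW].
  (* As [v] is in the class [ix k] of the maximal coordinate, the remaining coordinates multiply to
     [prod_nonmax], which is at most [f_pref P 0]. *)
  rewrite big_split prodr_const prodrXl vk -prod_nonmaxE //=.
  apply: ler_pM; rewrite ?exprn_ge0 //.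
  - by apply: prod_nonmax_ge0 => i; exact: rpos_ge0.
  - by apply: ler_weXn2l => //; rewrite -[leqRHS]card_ord max_card.
  apply: lerXn2r; rewrite ?nnegrE //.
    by apply: prod_nonmax_ge0 => i; exact: rpos_ge0.
  apply: le_trans fy; apply: le_bigmax_cond; apply/forallP => i.
  by rewrite rpos_ge0 rpos_le1.
apply: le_trans (ler_sum _ badP) _; rewrite sumr_const -[leLHS]mulr_natl.
apply: ler_wpM2r; first by rewrite exprn_ge0.
rewrite ler_nat; apply: leq_trans (max_card _) _.
rewrite card_prod card_ord leq_mul2r; apply/orP; right.
rewrite -sum1_card (partition_big part predT) //=.
rewrite (eq_bigr (fun=> n)); first by rewrite sum_nat_const card_ord.
by move=> i _; rewrite sum1_card sizeV.
Qed.

(** * Asymptotics in [ln d] *)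

Section Asymptotics.
Variable R : realType.
Implicit Types a c e M T : R.

(** Raise [c' * T <= expR (c' * T)] to the power [Q + 1], where [c' = c / (Q + 1)]: the spare factor
    [T] outgrows the constant [A / K]. *)
Lemma expR_dominates_poly (A c : R) Q : 0 < c -> 0 <= A ->
  exists2 T0, 0 < T0 & forall T, T0 <= T -> A * T ^+ Q <= expR (c * T).
Proof.
move=> c0 A0; pose c' := c / Q.+1%:R.
have c'0 : 0 < c' by rewrite divr_gt0.
pose K := c' ^+ Q.+1; have K0 : 0 < K by exact: exprn_gt0.
exists (1 + A / K); first by rewrite ltr_wpDr // divr_ge0 // ltW.
move=> T T0T.
have AK0 : 0 <= A / K by rewrite divr_ge0 // ltW.
have T0 : 0 <= T by lra.
apply: le_trans (_ : (c' * T) ^+ Q.+1 <= _).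
  rewrite exprMn -/K exprS mulrA ler_wpM2r ?exprn_ge0 //.
  by rewrite mulrC -ler_pdivrMr //; lra.
have -> : c * T = Q.+1%:R * (c' * T).
  by rewrite mulrA [_ * c']mulrC /c' divfK // pnatr_eq0.
rewrite expRM_natl; apply: lerXn2r; rewrite ?nnegrE ?expR_ge0 //.
  by rewrite mulr_ge0 // ltW.
by apply: le_trans (expR_ge1Dx _); rewrite lerDr.
Qed.

(* With y = exp (- b) and l close to (1 + e) ln d / a the choice of b gives
   d y^l <= C d^(- e/2), which absorbs the factors polynomial in ln d. *)
Lemma failure_vanishes (a e M delta : R) (r m s : nat) : 0 < a -> 0 < e ->
  0 < delta -> M + 1 <= s%:R * (e / 4) ->
  let b := a * (1 + e / 2) / (1 + e) in
  exists d0 : nat, forall d n l : nat, (d0 <= d)%N -> n%:R <= d%:R `^ M ->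
    l = Num.truncn ((1 + e) * (ln d%:R / a)) ->
    (m * s < l)%N /\
    (r * n * m)%:R * (d%:R * (((l * m)%:R ^+ (m * s) * expR m%:R) ^+ r
      * expR (- b) ^+ l)) ^+ s <= delta.
Proof.
move=> a0 e0 de0 sM b.
have b0 : 0 < b by rewrite divr_gt0 // ?mulr_gt0 //; lra.
pose K := (1 + e) / a; have K0 : 0 < K by rewrite divr_gt0 //; lra.
pose A := ((K * m%:R) ^+ (m * s) * expR m%:R) ^+ r * expR b.
have A0 : 0 <= A.
  rewrite mulr_ge0 ?expR_ge0 // exprn_ge0 // mulr_ge0 ?expR_ge0 //.
  by rewrite exprn_ge0 // mulr_ge0 // ltW.
have e40 : 0 < e / 4 by lra.
have [T1 T10 T1P] := expR_dominates_poly (m * s * r) e40 A0.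
pose T0 := T1 + (m * s).+1%:R / K.
pose z := expR T0 + (r * m)%:R / delta.
exists (Num.truncn z).+1 => d n l dd0 nM lE.
have dz : z < d%:R.
  apply: lt_le_trans (_ : (Num.truncn z).+1%:R <= _); last by rewrite ler_nat.
  have z0 : 0 <= z by rewrite addr_ge0 ?expR_ge0 // divr_ge0 // ltW.
  by have /andP[] := truncn_itv z0.
have rd0 : 0 <= (r * m)%:R / delta by rewrite divr_ge0 // ltW.
have d0 : 0 < d%:R :> R.
  by apply: le_lt_trans dz; rewrite addr_ge0 ?expR_ge0.
set T := ln d%:R in lE; have dT : d%:R = expR T by rewrite lnK ?posrE.
have T0T : T0 <= T.
  by rewrite -ler_expR -dT; apply: le_trans (ltW dz); rewrite lerDl.
have msK0 : 0 <= (m * s).+1%:R / K by rewrite divr_ge0 // ltW.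
have T1T : T1 <= T by apply: le_trans T0T; rewrite lerDl.
have Tpos : 0 < T by apply: lt_le_trans T1T.
have lE' : l = Num.truncn (K * T) by rewrite lE /K mulrA mulrAC.
have KT0 : 0 <= K * T by rewrite mulr_ge0 ?ltW.
have /andP[lK Kl] := truncn_itv KT0; rewrite -lE' in lK Kl.
split.
  rewrite lE' truncn_gt_nat mulrC -ler_pdivrMr //.
  by apply: le_trans T0T; rewrite lerDr ltW.
have p_le : ((l * m)%:R ^+ (m * s) * expR m%:R) ^+ r * expR (- b) ^+ l
    <= (A * T ^+ (m * s * r)) * expR (- ((1 + e / 2) * T)).
  have -> : A * T ^+ (m * s * r) * expR (- ((1 + e / 2) * T)) =
      ((K * T * m%:R) ^+ (m * s) * expR m%:R) ^+ r *
        (expR b * expR (- ((1 + e / 2) * T))).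
    rewrite exprM /A [K * T * _]mulrAC [(K * m%:R * T) ^+ _]exprMn.
    rewrite [_ * T ^+ _ * _]mulrAC [in RHS]exprMn.
    by rewrite !mulrA; congr (_ * _); rewrite mulrAC.
  have lm0 : 0 <= (l * m)%:R ^+ (m * s) * expR m%:R :> R.
    by rewrite mulr_ge0 ?expR_ge0 // exprn_ge0 // ler0n.
  have KTm0 : 0 <= K * T * m%:R by rewrite mulr_ge0.
  have KTm0' : 0 <= (K * T * m%:R) ^+ (m * s) * expR m%:R.
    by rewrite mulr_ge0 ?expR_ge0 // exprn_ge0.
  apply: ler_pM; rewrite ?exprn_ge0 ?expR_ge0 //.
    apply: lerXn2r; rewrite ?nnegrE //; apply: ler_wpM2r; first exact: expR_ge0.
    apply: lerXn2r; rewrite ?nnegrE ?ler0n //.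
    by rewrite natrM ler_wpM2r.
  rewrite -expRM_natl -expRD ler_expR.
  have -> : (1 + e / 2) * T = b * (K * T).
    rewrite mulrA /b /K; congr (_ * _).
    have e1 : 1 + e != 0 by rewrite gt_eqF //; lra.
    by rewrite mulrA divfK // [RHS]mulrAC divff ?mul1r // gt_eqF.
  (* Rounding [l] down costs at most a factor [expR b], which is included in [A]. *)
  have : b * (K * T) <= b * (l%:R + 1).
    by rewrite ler_wpM2l ?(ltW b0) // natr1 ltW.
  by rewrite mulrN mulrDr mulr1 [l%:R * b]mulrC; lra.
have dp_le : d%:R * (((l * m)%:R ^+ (m * s) * expR m%:R) ^+ r * expR (- b) ^+ l)
    <= expR (- (e / 4 * T)).
  (* Half of the saving [d ^ (- e / 2)] absorbs the polynomial factor, leaving [d ^ (- e / 4)]. *)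
  apply: le_trans (ler_wpM2l (ltW d0) p_le) _; rewrite dT mulrCA.
  apply: le_trans (_ : expR (e / 4 * T) * (expR T * expR (- ((1 + e / 2) * T))) <= _).
    by rewrite ler_wpM2r ?T1P // mulr_ge0 ?expR_ge0.
  by rewrite -!expRD ler_expR mulrDl mul1r; lra.
have sp_le : (d%:R * (((l * m)%:R ^+ (m * s) * expR m%:R) ^+ r
    * expR (- b) ^+ l)) ^+ s <= expR (- ((M + 1) * T)).
  apply: le_trans (_ : expR (- (e / 4 * T)) ^+ s <= _).
    apply: lerXn2r; rewrite ?nnegrE ?expR_ge0 //.
  rewrite -expRM_natl ler_expR mulrN lerN2 mulrA.
  by rewrite ler_wpM2r // ltW.
rewrite mulnAC natrM.
(* The factor [d ^ M] bounding [n] is beaten by [d ^ (- (M + 1))], which leaves [r * m / d]. *)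
apply: le_trans (_ : (r * m)%:R * expR (M * T) * expR (- ((M + 1) * T)) <= _).
  apply: ler_pM => //.
  rewrite ler_wpM2l //; move: nM; rewrite /powR gt_eqF //.
rewrite -mulrA -expRD (_ : M * T + _ = - T); last by rewrite mulrDl mul1r; lra.
rewrite expRN -dT ler_pdivrMr // mulrC -ler_pdivrMr // ltW //.
by apply: le_lt_trans dz; rewrite lerDr expR_ge0.
Qed.

End Asymptotics.

Theorem theorem1p7 (R : realType) (r : nat) (hr : (2 <= r)%N)
    (eps M : R) (heps : 0 < eps) (hM : 1 < M) :
  forall delta : R, 0 < delta ->
  exists d0 : nat, forall d : nat, (d0 <= d)%N ->
  forall (n : nat) (V : finType) (part : V -> 'I_r) (E : {set {set V}}),
    classes_of_size n part -> uniform r E -> partite part E ->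
    simple E -> regular d E ->
    n%:R <= d%:R `^ M ->
  forall l t : nat,
    l = Num.truncn ((1 + eps) * g0 R r * logb r%:R d%:R) -> (l <= t)%N ->
    1 - delta <= prob_lists R l (fun L : {ffun V -> {set 'I_t}} => chooseable E L).
Proof.
move=> delta delta0.
set f := f_inf r (0 : R); have f0 : 0 < f := f_inf0_gt0 R r.
have f1 : f < 1 := f_inf0_lt1 R hr.
pose a := - ln f; have a0 : 0 < a by rewrite oppr_gt0 ln_lt0 // f0.
(* Here [b < a] leaves room above [f] for a preference order, while
   [b * (1 + eps) / a = 1 + eps / 2 > 1] keeps [d * expR (- b) ^+ l] small. *)
pose b := a * (1 + eps / 2) / (1 + eps).
have ba : b < a.
  by rewrite ltr_pdivrMr ?ltr_pM2l //; lra.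
have fb : f < expR (- b).
  by rewrite -[ltLHS]lnK ?posrE // ltr_expR; rewrite ltrNr.
have [m [P [m0 hP fP]]] : exists m (P : 'I_r -> rel 'I_m),
    [/\ (0 < m)%N, preference_order P & f_pref P 0 < expR (- b)].
  apply: contrapT => none; move: fb; rewrite ltNge => /negP; apply.
  apply: le_f_inf => m P m0 hP; rewrite leNgt; apply/negP => fP.
  by apply: none; exists m, P.
(* [s], like [m] and [P], is fixed before [d]; it makes the [s]-th power of [d ^ (- eps / 4)] at
   most [d ^ (- (M + 1))]. *)
pose s := (Num.truncn ((M + 1) / (eps / 4))).+1.
have sM : M + 1 <= s%:R * (eps / 4).
  have e40 : 0 < eps / 4 by lra.
  have q0 : 0 <= (M + 1) / (eps / 4) by rewrite divr_ge0 ?ltW //; lra.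
  by rewrite -ler_pdivrMr // ltW //; have /andP[] := truncn_itv q0.
have [d0 d0P] := failure_vanishes r m a0 heps delta0 sM.
exists d0 => d dd0 n V part E sizeV _ partE simpE regE nM l t lE lt.
(* The factor [ln r] in [g0 R r] cancels the base of the logarithm of [d]. *)
have {}lE : l = Num.truncn ((1 + eps) * (ln d%:R / a)).
  rewrite lE g0E // -/f -/a /logb; congr Num.truncn.
  have lnr : ln r%:R != 0 :> R by rewrite gt_eqF // ln_gt0 // ltr1n.
  by rewrite -mulrA; congr (_ * _); rewrite mulrC mulrA divfK.
have [msl fail] := d0P d n l dd0 nM lE.
rewrite prob_listsC ?card_ord // lerD2l lerN2; apply: le_trans fail.
exact: prob_not_chooseable (ltW fP) _ msl lt sizeV partE simpE regE.
Qed.
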